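(* Let $(A_n)_{n\ge 1}$ be a sequence of random matrices defined on a common probability space, where $A_n=(\xi_{i,j})_{1\le i,j\le n}$ is an $n\times n$ matrix whose entries are strictly positive and identically distributed as a random variable $\xi$ (whose distribution does not depend on $n$). Assume that one of the following holds: I) for each $n$, the entries $(\xi_{i,j})_{1\le i,j\le n}$ of $A_n$ are independent; or II) for each $n$, $A_n$ is symmetric ($\xi_{i,j}=\xi_{j,i}$) and the entries $(\xi_{i,j})_{1\le i\le j\le n}$ are independent. Fix $0<\alpha<1$. (i) Almost surely $$\liminf_{n\to\infty}\ \min_{(k,B)}\frac{\log\operatorname{per}B}{k\log k}\ \ge\ 1,$$ where the minimum is over all integers $k$ with $\alpha n\le k\le n$ and all $k\times k$ submatrices $B$ of $A_n$. (ii) If $\xi$ has finite mean, then almost surely $$\limsup_{n\to\infty}\ \max_{(k,B)}\frac{\log\operatorname{per}B}{k\log k}\ =\ 1,$$ where the maximum is over all integers $k$ with $\alpha n\le k\le n$ and all $k\times k$ submatrices $B$ of $A_n$.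
   Context: The permanent of a $k\times k$ matrix $B=(b_{i,j})$ is $\operatorname{per}B=\sum_{\pi\in S_k}\prod_{i=1}^k b_{i,\pi(i)}$, where $S_k$ is the set of permutations of $\{1,\dots,k\}$. A submatrix of $A=(\xi_{i,j})$ is any matrix $(\xi_{i,j})_{i\in I,j\in J}$ with $I$ a set of row indices and $J$ a set of column indices (not necessarily intervals, and not necessarily $I=J$). The entries of $A_n$ may depend on $n$ (suppressed in the notation), and no assumption is made on the joint distribution of the matrices for different $n$. The quantities are considered for $n$ large enough that $k\ge\alpha n>1$. *)

(* Defs.v *)
From HB Require Import structures.
From mathcomp Require Import all_boot all_order all_algebra all_fingroup.
From mathcomp Require Import all_classical all_reals all_analysis.

Set Implicit Arguments.
Unset Strict Implicit.
Unset Printing Implicit Defensive.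

Import Order.TTheory GRing.Theory Num.Theory.
Import numFieldNormedType.Exports.

Local Open Scope classical_set_scope.
Local Open Scope ring_scope.

Definition permanent (R : realType) (k : nat) (B : 'M[R]_k) : R :=
  \sum_(s : 'S_k) \prod_(i < k) B i (s i).

(* [enum_val] lists a set of indices in increasing order; [castmx] only
   transports 'M_(#|I|, #|J|) to 'M_k. *)
Definition is_submatrix (R : realType) (k n : nat) (B : 'M[R]_k)
    (A : 'M[R]_n) : Prop :=
  exists (I J : {set 'I_n}) (cardI : #|I| = k) (cardJ : #|J| = k),
    B = castmx (cardI, cardJ)
          (\matrix_(i < #|I|, j < #|J|) A (enum_val i) (enum_val j)).

Definition log_permanent_ratios (R : realType) (alpha : R) (n : nat)
    (A : 'M[R]_n) : set (\bar R) :=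
  [set x | exists (k : nat) (B : 'M[R]_k),
     [/\ alpha * n%:R <= k%:R, (k <= n)%N, is_submatrix B A
       & x = (ln (permanent B) / (k%:R * ln k%:R))%:E]].

(* [log_permanent_ratios alpha A] is finite, and nonempty when alpha <= 1
   (take B = A), so the infimum and the supremum below are a minimum and a
   maximum. For alpha > 0 the degenerate values k <= 1, where k log k = 0,
   occur for finitely many n only and do not affect the limits. *)
Definition min_ratio (R : realType) (alpha : R) (n : nat) (A : 'M[R]_n)
    : \bar R :=
  ereal_inf (log_permanent_ratios alpha A).

Definition max_ratio (R : realType) (alpha : R) (n : nat) (A : 'M[R]_n)
    : \bar R :=
  ereal_sup (log_permanent_ratios alpha A).

(* The product rule over every subset J of the index set D. *)
Definition mutually_independent (d : measure_display) (T : measurableType d)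
    (R : realType) (P : probability T R) (I : finType) (D : {set I})
    (X : I -> {RV P >-> R}) : Prop :=
  forall (J : {set I}) (U : I -> set R), J \subset D ->
    (forall i, measurable (U i)) ->
    P (\bigcap_(i in [set` J]) (X i @^-1` U i))
      = (\prod_(i in J) P (X i @^-1` U i))%E.

Definition same_distribution (R : realType)
    (d d' : measure_display) (T : measurableType d) (T' : measurableType d')
    (P : probability T R) (Q : probability T' R)
    (X : {RV P >-> R}) (Y : {RV Q >-> R}) : Prop :=
  forall U : set R, measurable U -> distribution P X U = distribution Q Y U.

Definition random_matrix (d : measure_display) (T : measurableType d)
    (R : realType) (P : probability T R) (n : nat)
    (A : 'I_n -> 'I_n -> {RV P >-> R}) (w : T) : 'M[R]_n :=
  \matrix_(i < n, j < n) A i j w.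

Definition independent_entries (d : measure_display) (T : measurableType d)
    (R : realType) (P : probability T R) (n : nat)
    (A : 'I_n -> 'I_n -> {RV P >-> R}) : Prop :=
  mutually_independent [set: 'I_n * 'I_n]%SET (fun p => A p.1 p.2).

Definition symmetric_independent_entries (d : measure_display)
    (T : measurableType d) (R : realType) (P : probability T R) (n : nat)
    (A : 'I_n -> 'I_n -> {RV P >-> R}) : Prop :=
  {ae P, forall w, (random_matrix A w)^T = random_matrix A w} /\
  mutually_independent [set p : 'I_n * 'I_n | (p.1 <= p.2)%N]%SET
    (fun p => A p.1 p.2).

(* Main.v *)
(* Lower bound. Choose delta so small that an entry is below delta with tiny
   probability. By a Chernoff bound and Borel-Cantelli, almost surely for n
   large every row and every column of A_n has at most (2/r) n entries below
   delta, hence every k x k submatrix with k >= alpha n has at most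
   b <= (2/(r alpha)) k of them in each row and column. Expanding along rows,
   such a submatrix has at least (k - 2b)! permutations that avoid the small
   entries, so its permanent is at least delta^k (k - 2b)!.

   Upper bound. With c = 1/(n mu), bounding each row sum by
   c^-1 prod_j (1 + c A_ij) gives, for all k x k submatrices B of A_n at once,
   per B <= prod (row sums) <= (n mu)^k prod_(i,j) (1 + c A_ij),
   where the last product runs over the whole of A_n. Over a triangle of A_n,
   where the entries are independent, that product has expectation at most
   (1 + 1/n)^(n^2) <= e^n, so Markov and Borel-Cantelli bound it by e^(2n).

   Both cases I and II are treated through the two closed triangles of A_n,
   each of which consists of independent entries. *)

Require Import Defs.
From HB Require Import structures.
From mathcomp Require Import all_boot all_order all_algebra all_fingroup.
From mathcomp Require Import all_classical all_reals all_analysis.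
From mathcomp Require Import measurable_realfun zify ring lra.

Set Implicit Arguments.
Unset Strict Implicit.
Unset Printing Implicit Defensive.

Import Order.TTheory GRing.Theory Num.Theory.
Import numFieldNormedType.Exports.

Local Open Scope classical_set_scope.
Local Open Scope ring_scope.

(** * Bounds on the permanent of a nonnegative matrix *)

(** The permutations are grouped by their value j at [ord0]; [lift_perm ord0 j] is a bijection from
    the permutations of the minor onto the group of j. *)
Lemma permanent_expand (R : realType) (n : nat) (B : 'M[R]_n.+1) :
  permanent B = \sum_j B ord0 j * permanent (row' ord0 (col' j B)).
Proof.
rewrite /permanent (partition_big (fun s : 'S_n.+1 => s ord0) xpredT) //=.
apply: eq_bigr => j _; rewrite big_distrr /=.
rewrite (reindex (lift_perm ord0 j)); last first.
  (* [ulsf i s] is what s induces once i and its image are deleted. The default k is never returned,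
     since s (lift i k) differs from s i. *)
  pose ulsf i (s : 'S_n.+1) k := odflt k (unlift (s i) (s (lift i k))).
  have ulsfK i (s : 'S_n.+1) k: lift (s i) (ulsf i s k) = s (lift i k).
    rewrite /ulsf; have:= neq_lift i k.
    by rewrite -(can_eq (permK s)) => /unlift_some[] ? ? ->.
  have inj_ulsf: injective (ulsf ord0 _).
    move=> s; apply: can_inj (ulsf (s ord0) s^-1%g) _ => k'.
    by rewrite {1}/ulsf ulsfK !permK liftK.
  exists (fun s => perm (inj_ulsf s)) => [s _ | s].
    by apply/permP=> k'; rewrite permE /ulsf lift_perm_lift lift_perm_id liftK.
  move/(s _ =P _) => si; apply/permP=> k.
  case: (unliftP ord0 k) => [k'|] ->; rewrite ?lift_perm_id //.
  by rewrite lift_perm_lift -si permE ulsfK.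
apply: eq_big => [s|s _]; first by rewrite lift_perm_id eqxx.
rewrite big_ord_recl lift_perm_id; congr (_ * _).
by apply: eq_bigr => i _; rewrite !mxE lift_perm_lift.
Qed.

Lemma permanent_ge0 (R : realType) (n : nat) (B : 'M[R]_n) :
  (forall i j, 0 <= B i j) -> 0 <= permanent B.
Proof. by move=> B0; apply: sumr_ge0 => s _; apply: prodr_ge0. Qed.

Lemma permanent_ge_perm (R : realType) (n : nat) (B : 'M[R]_n) (s : 'S_n) :
  (forall i j, 0 <= B i j) -> \prod_i B i (s i) <= permanent B.
Proof.
move=> B0; rewrite /permanent (bigD1 s) //= lerDl.
by apply: sumr_ge0 => t _; apply: prodr_ge0.
Qed.

(** Induction along the first row: deleting a column only removes a nonnegative term from each
    remaining row sum. *)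
Lemma permanent_le_prod_sum (R : realType) (n : nat) (B : 'M[R]_n) :
  (forall i j, 0 <= B i j) -> permanent B <= \prod_i \sum_j B i j.
Proof.
elim: n B => [|n IHn] B B0.
  rewrite /permanent big_ord0 (eq_bigr (fun=> 1)) => [|s _]; last by rewrite big_ord0.
  by rewrite sumr_const card_Sn.
rewrite permanent_expand [leRHS]big_ord_recl mulr_suml.
apply: ler_sum => j _; apply: ler_wpM2l => //.
apply: le_trans (IHn _ _) _ => [i k|]; first by rewrite !mxE.
apply: ler_prod => i _; rewrite sumr_ge0 /= => [|k _]; last by rewrite !mxE.
rewrite [leRHS](bigD1_ord j) //= ler_wpDl //.
by apply: ler_sum => k _; rewrite !mxE.
Qed.

(* In a permutation with the fewest bad entries, a bad entry (i, s i) could be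
   removed by exchanging the images of i and of some l, since each of (i, s l)
   and (l, s i) is bad for at most b values of l, and both are for l = i. *)
Lemma permutation_avoiding (n b : nat) (bad : rel 'I_n) :
  (forall i, #|[set j | bad i j]%SET| <= b)%N ->
  (forall j, #|[set i | bad i j]%SET| <= b)%N ->
  (b.*2 <= n)%N -> exists s : 'S_n, forall i, ~~ bad i (s i).
Proof.
move=> rowb colb bn.
pose nb (s : 'S_n) := #|[set i | bad i (s i)]%SET|.
case: (@arg_minnP _ (1%g : 'S_n) xpredT nb isT) => s _ smin.
exists s => i; apply/negP => badi.
pose L1 := [set l | bad i (s l)]%SET; pose L2 := [set l | bad l (s i)]%SET.
have cL1 : (#|L1| <= b)%N.
  apply: leq_trans (rowb i); rewrite -(card_imset _ (@perm_inj _ s)).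
  by apply/subset_leq_card/fintype.subsetP => _ /imsetP[l + ->]; rewrite !inE.
have cL2 : (#|L2| <= b)%N by exact: colb.
have cLI : (0 < #|L1 :&: L2|)%N by apply/card_gt0P; exists i; rewrite !inE badi.
have : (0 < #|~: (L1 :|: L2)|)%N.
  have := cardsUI L1 L2; have := cardsC (L1 :|: L2); rewrite card_ord.
  move: cL1 cL2 cLI bn; rewrite -addnn.
  move: #|L1| #|L2| #|L1 :|: L2| #|L1 :&: L2| #|~: (L1 :|: L2)|.
  by move=> ? ? ? ? ?; lia.
case/card_gt0P => l; rewrite !inE negb_or => /andP[badil badli].
have := smin (tperm i l * s)%g isT; apply/negP; rewrite -ltnNge.
apply: proper_card; apply/fintype.properP; split.
  apply/fintype.subsetP => m; rewrite !inE permM.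
  by case: tpermP => [->|->|//]; rewrite ?(negPf badil) ?(negPf badli).
by exists i; rewrite !inE // permM tpermL.
Qed.

(** Induction on k with b fixed, since a minor has no more small entries per line than B. As long as
    2b is at most the size of the minors, the first row has enough entries that are at least delta
    to supply the next factor of the factorial. When 2b reaches the full size, the factorial is 1
    and a single permutation from [permutation_avoiding] suffices. *)
Lemma permanent_ge_fact (R : realType) (delta : R) (b k : nat) (B : 'M[R]_k) :
  0 <= delta -> (forall i j, 0 <= B i j) ->
  (forall i, #|[set j | (B i j < delta)%R]%SET| <= b)%N ->
  (forall j, #|[set i | (B i j < delta)%R]%SET| <= b)%N ->
  (b.*2 <= k)%N -> delta ^+ k * ((k - b.*2)`!)%:R <= permanent B.
Proof.
move=> d0; elim: k B => [|k IHk] B B0 rowb colb bk.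
  by apply: le_trans (permanent_ge_perm 1%g B0); rewrite big_ord0 mul1r sub0n.
have [bk1|bk1] := leqP k.+1 b.*2.
  have [s sP] := @permutation_avoiding _ b [rel i j | B i j < delta] rowb colb bk.
  have -> : (k.+1 - b.*2 = 0)%N by lia.
  rewrite mulr1; apply: le_trans (permanent_ge_perm s B0).
  rewrite -[X in _ ^+ X]card_ord -prodr_const.
  by apply: ler_prod => i _; rewrite d0 leNgt; exact: sP.
rewrite ltnS in bk1; rewrite permanent_expand.
have minor_ge j : delta ^+ k * ((k - b.*2)`!)%:R <=
    permanent (row' ord0 (col' j B)).
  apply: IHk => // [i l|i|l]; first by rewrite !mxE.
    apply: leq_trans (rowb (lift ord0 i)).
    rewrite -(card_imset _ (@lift_inj _ j)); apply/subset_leq_card.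
    by apply/fintype.subsetP => _ /imsetP[l + ->]; rewrite !inE !mxE.
  apply: leq_trans (colb (lift j l)).
  rewrite -(card_imset _ (@lift_inj _ ord0)); apply/subset_leq_card.
  by apply/fintype.subsetP => _ /imsetP[i + ->]; rewrite !inE !mxE.
set m := delta ^+ k * _ in minor_ge.
have m0 : 0 <= m by rewrite mulr_ge0 ?exprn_ge0.
rewrite (bigID (fun j => B ord0 j < delta)) /= ler_wpDl //.
  apply: sumr_ge0 => j _; rewrite mulr_ge0 // permanent_ge0 // => i l.
  by rewrite !mxE.
apply: (@le_trans _ _ (\sum_(j | ~~ (B ord0 j < delta)) delta * m)).
  rewrite sumr_const subSn // factS natrM exprS.
  have -> : delta * delta ^+ k * ((k - b.*2).+1%:R * ((k - b.*2)`!)%:R)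
      = delta * m *+ (k - b.*2).+1 by rewrite /m -mulr_natr; ring.
  have dm0 : 0 <= delta * m by rewrite mulr_ge0.
  apply: ler_wpMn2l => //.
  have := rowb ord0; have := cardC [pred j | (B ord0 j < delta)%R].
  rewrite card_ord cardsE => cC cle.
  apply: (@leq_trans #|[predC [pred j | (B ord0 j < delta)%R]]|).
    move: cC cle; move: #|_| #|_| => ? ?; lia.
  by apply/subset_leq_card/fintype.subsetP.
apply: ler_sum => j; rewrite -leNgt => dj.
exact: ler_pM.
Qed.

(** * Deterministic bounds on the two ratios *)

(** The weak half of Stirling's formula. The induction step amounts to m ln(1 + 1/m) <= 1. *)
Lemma ln_fact_ge (R : realType) (m : nat) :
  m%:R * ln m%:R - m%:R <= ln (m`!)%:R :> R.
Proof.
elim: m => [|m IHm]; first by rewrite mul0r subr0 fact0 ln1.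
rewrite factS natrM lnM ?posrE ?ltr0n ?fact_gt0 //.
apply: (le_trans _ (lerD (lexx _) IHm)).
case: m {IHm} => [|m]; first by rewrite ln1 !mulr0 mul0r sub0r subr0 addr0 lerN10.
have m0 : 0 < m.+1%:R :> R by rewrite ltr0n.
have -> : m.+2%:R = m.+1%:R * (1 + m.+1%:R^-1) :> R.
  by rewrite mulrDr mulr1 divff ?gt_eqF // natr1.
have m1 : 0 < m.+1%:R^-1 :> R by rewrite invr_gt0.
rewrite lnM ?posrE ?addr_gt0 //.
have lnle : m.+1%:R * ln (1 + m.+1%:R^-1) <= 1 :> R.
  by rewrite mulrC -ler_pdivlMr // mul1r le_ln1Dx // (lt_trans _ m1) // ltrN10.
have NV : m.+1%:R * m.+1%:R^-1 = 1 :> R by rewrite divff ?gt_eqF.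
set N := m.+1%:R in lnle NV *; set l := ln (1 + _) in lnle *.
have -> : N * (1 + N^-1) = N + 1 by rewrite mulrDr NV mulr1.
by move: (ln N) => z; nra.
Qed.

(** The expanded product contains 1 and every [c * x i] among its nonnegative terms. A sum is thus
    traded for a product, whose expectation factorizes under independence. *)
Lemma sum_le_prod1D (R : realType) (I : finType) (c : R) (x : I -> R) :
  0 < c -> (forall i, 0 <= x i) -> \sum_i x i <= c^-1 * \prod_i (1 + c * x i).
Proof.
move=> c0 x0; rewrite -ler_pdivrMl ?invr_gt0 // invrK mulr_sumr.
suff [_ sum_le] : 0 <= \sum_i c * x i /\ 1 + \sum_i c * x i <= \prod_i (1 + c * x i).
  by apply: le_trans sum_le; rewrite lerDr.
elim/big_rec2: _ => [|i u v _ [v0 uv]]; first by rewrite addr0.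
have cx0 : 0 <= c * x i by rewrite mulr_ge0 // ltW.
split; nra.
Qed.

Lemma submatrix_entries (R : realType) (k n : nat) (B : 'M[R]_k) (A : 'M[R]_n) :
  is_submatrix B A -> exists f g : 'I_k -> 'I_n,
    [/\ injective f, injective g & forall i j, B i j = A (f i) (g j)].
Proof.
case=> I [J] [cI] [cJ] ->; exists (fun i => enum_val (cast_ord (esym cI) i)).
exists (fun j => enum_val (cast_ord (esym cJ) j)); split.
- by move=> i i' /enum_val_inj /cast_ord_inj.
- by move=> i i' /enum_val_inj /cast_ord_inj.
- by move=> i j; rewrite castmxE mxE.
Qed.

(** The row sums of B are enlarged to those of A, and the factors of the missing rows are at least
    1. The bound depends on B only through k, so no union bound over submatrices is needed later. *)
Lemma permanent_submatrix_le (R : realType) (k n : nat) (c : R) (B : 'M[R]_k)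
    (A : 'M[R]_n) :
  0 < c -> (forall i j, 0 <= A i j) -> is_submatrix B A ->
  permanent B <= c^-1 ^+ k * \prod_i \prod_j (1 + c * A i j).
Proof.
move=> c0 A0 /submatrix_entries[f [g [f_inj g_inj BE]]].
have fac_ge1 i j : 1 <= 1 + c * A i j by rewrite lerDl mulr_ge0 // ltW.
have row_ge1 i : 1 <= \prod_j (1 + c * A i j).
  by elim/big_rec: _ => // j x _ x1; apply: mulr_ege1.
apply: le_trans (permanent_le_prod_sum _) _ => [i j|]; first by rewrite BE.
apply: (@le_trans _ _ (\prod_(i < k) (c^-1 * \prod_j (1 + c * A (f i) j)))).
  apply: ler_prod => i _; rewrite sumr_ge0 /= => [|j _]; last by rewrite BE.
  apply: (@le_trans _ _ (\sum_j A (f i) j)); last exact: sum_le_prod1D.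
  rewrite (eq_bigr (fun j => A (f i) (g j))) => [|j _]; last by rewrite BE.
  rewrite -(big_imset (fun j => A (f i) j) (h := g) (A := predT)) /=; last first.
    by move=> ? ? _ _; exact: g_inj.
  rewrite [leRHS](bigID (fun j => j \in (g @: predT)%SET)) /= lerDl.
  by apply: sumr_ge0.
rewrite big_split /= prodr_const card_ord; apply: ler_wpM2l.
  by rewrite exprn_ge0 // invr_ge0 ltW.
rewrite -(big_imset (fun i => \prod_j (1 + c * A i j)) (h := f)
  (A := predT)) /=; last first.
  by move=> ? ? _ _; exact: f_inj.
rewrite [leRHS](bigID (fun i => i \in (f @: predT)%SET)) /= ler_peMr //.
  by apply: prodr_ge0 => i _; apply: le_trans (row_ge1 i).
by elim/big_rec: _ => // i x _ x1; apply: mulr_ege1.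
Qed.

(** The threshold on n is uniform in k; it serves to absorb errors of order k into eps k ln k.
    Replacing M by at least 1 also secures k > 1 and ln k > 0. *)
Lemma ln_large (R : realType) (alpha M : R) : 0 < alpha ->
  exists n0 : nat, forall n k : nat, (n0 <= n)%N -> alpha * n%:R <= k%:R ->
    [/\ (1 < k)%N, 0 < ln (k%:R : R) & M <= ln (k%:R : R)].
Proof.
move=> a0; pose M1 := Num.max M 1.
exists (Num.bound (expR M1 / alpha)) => n k n0n ank.
have Mk : expR M1 <= k%:R.
  apply: le_trans ank; rewrite mulrC -ler_pdivrMr //.
  apply: le_trans (_ : (Num.bound (expR M1 / alpha))%:R <= _); last by rewrite ler_nat.
  by apply/ltW/archi_boundP; rewrite divr_ge0 ?expR_ge0 // ltW.
have M1k : M1 <= ln k%:R.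
  by rewrite -[M1]expRK ler_ln ?posrE ?expR_gt0 // (lt_le_trans (expR_gt0 M1)).
split.
- rewrite -(ltr_nat R); apply: lt_le_trans Mk.
  apply: (@lt_le_trans _ _ (1 + M1)); last exact: expR_ge1Dx.
  by rewrite ltrDl lt_max ltr01 orbT.
- by apply: lt_le_trans M1k; rewrite lt_max ltr01 orbT.
- by apply: le_trans M1k; rewrite le_max lexx.
Qed.

(** Take c = 1/(n mu) in [permanent_submatrix_le]. Since n <= k/alpha, ln per B is at most k ln k +
    k (ln mu - ln alpha + C/alpha), and the threshold on ln k makes the last term at most eps k ln
    k. *)
Lemma max_ratio_le (R : realType) (alpha eps mu C : R) :
  0 < alpha -> 0 < eps -> 0 < mu -> 0 <= C ->
  exists n0 : nat, forall (n : nat) (A : 'M[R]_n), (n0 <= n)%N ->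
    (forall i j, 0 < A i j) ->
    \prod_i \prod_j (1 + (n%:R * mu)^-1 * A i j) <= expR (C * n%:R) ->
    (max_ratio alpha A <= (1 + eps)%:E)%E.
Proof.
move=> a0 e0 mu0 C0.
have [n0 n0P] := @ln_large R alpha ((ln mu - ln alpha + C / alpha) / eps) a0.
exists n0 => n A n0n A0 prodA; apply: ge_ereal_sup => _ [k [B [ak kn BA ->]]].
have [k1 lnk0 lnkM] := n0P _ _ n0n ak.
have k0 : 0 < k%:R :> R by rewrite ltr0n; lia.
have n1 : 0 < n%:R :> R by rewrite ltr0n; lia.
have [f [g [f_inj g_inj BE]]] := submatrix_entries BA.
have perm0 : 0 < permanent B.
  apply: lt_le_trans (@permanent_ge_perm _ _ _ 1%g _) => [|i j].
    by apply: prodr_gt0 => i _; rewrite BE.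
  by rewrite BE ltW.
rewrite lee_fin ler_pdivrMr ?mulr_gt0 //.
have : permanent B <= (n%:R * mu) ^+ k * expR (C * n%:R).
  apply: le_trans (@permanent_submatrix_le _ _ _ (n%:R * mu)^-1 _ _ _ _ BA) _.
  - by rewrite invr_gt0 mulr_gt0.
  - by move=> i j; rewrite ltW.
  - by rewrite invrK ler_wpM2l // exprn_ge0 // mulr_ge0 ?ltW.
rewrite -ler_ln ?posrE // ?mulr_gt0 ?exprn_gt0 ?expR_gt0 ?mulr_gt0 //.
move=> /le_trans; apply.
rewrite lnM ?posrE ?exprn_gt0 ?expR_gt0 ?mulr_gt0 // expRK lnXn ?mulr_gt0 //.
rewrite lnM ?posrE // -[X in X + _ <= _]mulr_natl.
have lnn : ln n%:R <= ln k%:R - ln alpha.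
  by rewrite lerBrDl -lnM ?posrE // ler_ln ?posrE ?mulr_gt0.
have Cn : C * n%:R <= C / alpha * k%:R.
  by rewrite -mulrA ler_wpM2l // mulrC ler_pdivlMr // mulrC.
rewrite ler_pdivrMr // in lnkM.
move: lnn Cn lnkM; move: (C / alpha) (C * _) (ln k%:R) (ln n%:R) (ln mu) (ln alpha).
move=> x y z t u v lnn Cn lnkM.
have : k%:R * (t + u) <= k%:R * (z - v + u) by rewrite ler_pM2l // lerD2r.
have : k%:R * (u - v + x) <= k%:R * (z * eps) by rewrite ler_pM2l.
lra.
Qed.

(** The order of the quantifiers matters: r depends on alpha and eps only, so that delta can
    afterwards be adapted to r. *)
Lemma min_ratio_ge (R : realType) (alpha eps : R) :
  0 < alpha -> 0 < eps -> eps <= 1 ->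
  exists r : nat, (0 < r)%N /\ forall delta : R, 0 < delta ->
  exists n0 : nat, forall (n : nat) (A : 'M[R]_n), (n0 <= n)%N ->
    (forall i j, 0 < A i j) ->
    (forall i, r * #|[set j | (A i j < delta)%R]%SET| <= n.*2)%N ->
    (forall j, r * #|[set i | (A i j < delta)%R]%SET| <= n.*2)%N ->
    ((1 - eps)%:E <= min_ratio alpha A)%E.
Proof.
(* The 8 yields 2b <= 4n/r <= 4k/(alpha r) <= (eps/2) k for the bound b = floor(2n/r) on the small
   entries of a line. *)
move=> a0 e0 e1; pose r := (Num.bound (8 / (alpha * eps))).+1.
have rP : 8 <= eps * (alpha * r%:R).
  rewrite mulrA mulrC -ler_pdivrMr ?mulr_gt0 // mulrC [eps * _]mulrC; apply/ltW.
  apply: lt_le_trans (archi_boundP _) _; first by rewrite mulrC divr_ge0 // mulr_ge0 ?ltW.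
  by rewrite mulrC ler_nat.
exists r; split=> // delta d0.
(* With m = k - 2b >= (1 - eps/2) k and ln m >= ln k - 1, the quantity k ln delta + m ln m - m is at
   least (1 - eps/2) k ln k - k (2 - ln delta). This threshold makes the loss at most (eps/2) k ln
   k. *)
have [n0 n0P] := @ln_large R alpha ((2 - ln delta) * 2 / eps) a0.
exists n0 => n A n0n A0 rowA colA; apply: le_ereal_inf_tmp => _ [k [B [ak kn BA ->]]].
have [k1 lnk0 lnkM] := n0P _ _ n0n ak.
have k0 : 0 < k%:R :> R by rewrite ltr0n; lia.
have [f [g [f_inj g_inj BE]]] := submatrix_entries BA.
rewrite lee_fin ler_pdivlMr ?mulr_gt0 //.
pose b := (n.*2 %/ r)%N; pose m := (k - b.*2)%N.
have bk : b.*2%:R <= eps / 2 * k%:R :> R.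
  have : (r * b)%:R <= n.*2%:R :> R by rewrite ler_nat mulnC leq_trunc_div.
  rewrite natrM -!mul2n !natrM => rb.
  have r0 : 0 < r%:R :> R by rewrite ltr0n.
  have h1 : alpha * (r%:R * b%:R) <= 2 * k%:R.
    by apply: le_trans (_ : alpha * (2 * n%:R) <= _); [rewrite ler_pM2l|lra].
  have h2 : 8 * b%:R <= eps * (alpha * r%:R) * b%:R by rewrite ler_wpM2r.
  have h3 : eps * (alpha * (r%:R * b%:R)) <= eps * (2 * k%:R) by rewrite ler_pM2l.
  lra.
have bk1 : (b.*2 <= k)%N by rewrite -(ler_nat R); nra.
have mE : m%:R = k%:R - b.*2%:R :> R by rewrite natrB.
have fact_le : delta ^+ k * m`!%:R <= permanent B.
  apply: permanent_ge_fact => // [|i j|i|j].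
  - exact: ltW.
  - by rewrite BE ltW.
  - rewrite leq_divRL // mulnC; apply: leq_trans (rowA (f i)); rewrite leq_mul2l.
    apply/orP; right; rewrite -(card_imset _ g_inj); apply/subset_leq_card.
    by apply/fintype.subsetP => _ /imsetP[j + ->]; rewrite !inE BE.
  - rewrite leq_divRL // mulnC; apply: leq_trans (colA (g j)); rewrite leq_mul2l.
    apply/orP; right; rewrite -(card_imset _ f_inj); apply/subset_leq_card.
    by apply/fintype.subsetP => _ /imsetP[i + ->]; rewrite !inE BE.
have lhs0 : 0 < delta ^+ k * m`!%:R by rewrite mulr_gt0 ?exprn_gt0 ?ltr0n ?fact_gt0.
have : ln (delta ^+ k * m`!%:R) <= ln (permanent B).
  by rewrite ler_ln ?posrE // (lt_le_trans lhs0).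
apply: le_trans.
rewrite lnM ?posrE ?exprn_gt0 ?ltr0n ?fact_gt0 // lnXn // -[X in _ <= X + _]mulr_natl.
apply: le_trans (_ : k%:R * ln delta + (m%:R * ln m%:R - m%:R) <= _); last first.
  by rewrite lerD2l ln_fact_ge.
have km2 : k%:R / 2 <= m%:R :> R by rewrite mE; nra.
have m1 : 1 <= m%:R :> R.
  by apply: le_trans km2; rewrite ler_pdivlMr // mul1r ler_nat.
have lnm : ln k%:R - 1 <= ln m%:R :> R.
  rewrite lerBlDr; apply: le_trans (_ : ln m%:R + ln (1 + 1) <= _); last first.
    by rewrite lerD2l le_ln1Dx // (lt_trans _ ltr01) // ltrN10.
  rewrite -lnM ?posrE ?(lt_le_trans ltr01) // ?lerDl // ler_ln ?posrE //; lra.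
rewrite ler_pdivrMr // in lnkM.
have lnm0 : 0 <= ln m%:R :> R by exact: ln_ge0.
have mk : m%:R <= k%:R :> R by rewrite ler_nat leq_subr.
have h1 : k%:R * ((2 - ln delta) * 2) <= k%:R * (ln k%:R * eps) by rewrite ler_pM2l.
have h2 : (1 - eps / 2) * k%:R * (ln k%:R - 1) <= m%:R * ln m%:R.
  apply: le_trans (_ : (1 - eps / 2) * k%:R * ln m%:R <= _).
    by rewrite ler_wpM2l // mulr_ge0 ?ltW //; lra.
  by rewrite ler_wpM2r // mE; lra.
nra.
Qed.

(** * Probabilistic tools *)

Lemma prod_indic (T R : Type) (S : numDomainType) (I : finType) (D : {set I})
    (X : I -> T -> R) (V : I -> set R) (w : T) :
  \prod_(p in D) \1_(V p) (X p w)
    = \1_(\bigcap_(p in [set` D]) X p @^-1` V p) w :> S.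
Proof.
rewrite [RHS]indicE; have [inV|] := pselect ((\bigcap_(p in [set` D]) X p @^-1` V p) w).
  rewrite mem_set // big1 // => p pD; rewrite indicE mem_set //.
  exact: inV.
move=> ninV; rewrite memNset //.
have [p pD nVp] : exists2 p, p \in D & ~ V p (X p w).
  apply: contrapT => np; apply: ninV => p pD; apply: contrapT => nVp.
  by apply: np; exists p.
by rewrite (bigD1 p) //= indicE memNset // mul0r.
Qed.

Lemma measurable_RV_preimage (d : measure_display) (T : measurableType d)
    (R : realType) (P : probability T R) (X : {RV P >-> R}) (U : set R) :
  measurable U -> measurable (X @^-1` U).
Proof. by move=> mU; rewrite -[X in measurable X]setTI; exact: measurable_funPT. Qed.

(* Markov's inequality, the expectation of the product being computed by
   expanding it into a sum of indicators of rectangles. *)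
Lemma prod_simple_markov (d : measure_display) (T : measurableType d)
    (R : realType) (P : probability T R) (I : finType) (D : {set I})
    (X : I -> {RV P >-> R}) (K : finType) (k0 : K) (a : K -> R)
    (V : K -> set R) (t s : R) :
  mutually_independent D X -> (forall k, 0 <= a k) ->
  (forall k, measurable (V k)) -> 0 < t ->
  (forall p, p \in D -> \sum_k a k * fine (P (X p @^-1` V k)) <= s) ->
  measurable [set w | t <= \prod_(p in D) \sum_k a k * \1_(V k) (X p w)] /\
  (P [set w | (t <= \prod_(p in D) \sum_k a k * \1_(V k) (X p w))%R]
    <= (s ^+ #|D| / t)%:E)%E.
Proof.
move=> indepX a0 mV t0 sP.
pose Z w : R := \prod_(p in D) \sum_k a k * \1_(V k) (X p w).
pose rect (f : {ffun I -> K}) := \bigcap_(p in [set` D]) X p @^-1` V (f p).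
pose coef (f : {ffun I -> K}) := \prod_(p in D) a (f p).
have mX p k : measurable (X p @^-1` V k) by exact: measurable_RV_preimage.
have mrect f : measurable (rect f).
  by apply: fin_bigcap_measurable => // p _; exact: mX.
have coef0 f : 0 <= coef f by apply: prodr_ge0.
(* One k is chosen for each p in D; fixing the value [k0] outside D counts each choice once. *)
pose rects := enum (pffun_on k0 (mem D) predT).
have ZE : Z = fun w => \sum_(f <- rects) coef f * \1_(rect f) w.
  apply/funext => w; rewrite /Z (big_distr_big k0) -big_enum /=; apply: eq_bigr => f _.
  by rewrite big_split /= (prod_indic _ _ (fun p => X p) (fun p => V (f p))).
have mZ : measurable_fun [set: T] (EFin \o Z).
  apply/measurable_EFinP; rewrite ZE.
  apply: measurable_sum => f; apply: measurable_funM => //.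
have Z0 w : 0 <= Z w.
  by apply: prodr_ge0 => p _; apply: sumr_ge0 => k _; rewrite mulr_ge0.
have intZ : (\int[P]_w (Z w)%:E <= (s ^+ #|D|)%:E)%E.
  under eq_integral do rewrite ZE -sumEFin.
  rewrite ge0_integral_sum //=; last 2 first.
  - by move=> f; apply/measurable_EFinP; apply: measurable_funM.
  - by move=> f w _; rewrite lee_fin mulr_ge0.
  rewrite (eq_bigr (fun f : {ffun I -> K} =>
      (\prod_(p in D) (a (f p) * fine (P (X p @^-1` V (f p)))))%:E)) => [|f _].
    rewrite sumEFin lee_fin /rects big_enum /=.
    pose q p k := a k * fine (P (X p @^-1` V k)).
    (* The same distributivity, read backwards, turns the sum over rectangles into a product of
       expectations. *)
    have := esym (big_distr_big k0 (mem D) predT q : _ = _ :> R).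
    rewrite /q => ->.
    rewrite -prodr_const; apply: ler_prod => p pD; rewrite sP // andbT.
    by apply: sumr_ge0 => k _; rewrite mulr_ge0 // fine_ge0.
  under eq_integral do rewrite EFinM.
  rewrite ge0_integralZl_EFin //; last exact/measurable_EFinP.
  rewrite integral_indic // setIT.
  have Prect := indepX D (fun p => V (f p)) (subxx D) (fun p => mV (f p)).
  rewrite big_split EFinM; congr (_ * _)%E; apply: eq_trans Prect _.
  rewrite -prodEFin.
  by apply: eq_bigr => p _; rewrite fineK // fin_num_measure.
have mE : measurable [set w | t <= Z w].
  rewrite -[X in measurable X]setTI.
  rewrite (_ : setT `&` _ = setT `&` [set w | (t%:E <= (Z w)%:E)%E]) //.
  exact: emeasurable_fun_c_infty.
split=> //.
rewrite EFinM lee_pdivlMr //; apply: le_trans intZ.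
rewrite -[X in P X]setIT -integral_indic // -ge0_integralZr //=.
apply: ge0_le_integral => //=.
- by move=> w _; rewrite mule_ge0 // lee_fin // ltW.
- by apply: emeasurable_funM => //; exact/measurable_EFinP.
- move=> w _; rewrite -EFinM lee_fin indicE.
  have [tZ|/negP tZ] := boolP (t <= Z w); first by rewrite mem_set // mul1r.
  by rewrite memNset // mul0r.
- exact/measurable_EFinP.
- by rewrite lee_fin ltW.
Qed.

(** Continuity from above. It provides both the level delta of the lower bound and the truncation
    level L of the upper bound. *)
Lemma nonincreasing_measure_small (d : measure_display) (T : measurableType d)
    (R : realType) (P : probability T R) (F : (set T)^nat) (eps : R) :
  (forall n, measurable (F n)) -> {homo F : n m / (n <= m)%N >-> (m <= n)%O} ->
  P (\bigcap_n F n) = 0%E -> 0 < eps -> exists n, (P (F n) <= eps%:E)%E.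
Proof.
move=> mF F_noninc PF0 eps0; apply: contrapT => nex.
have : (P \o F) n @[n --> \oo] --> P (\bigcap_n F n).
  apply: nonincreasing_cvg_mu => //; first by rewrite -ge0_fin_numE // fin_num_measure.
  exact: bigcap_measurable.
rewrite PF0 => PF_cvg; have : (eps%:E <= limn (P \o F))%E.
  apply: lime_ge; first by apply/cvg_ex; exists 0%E.
  apply: nearW => n; rewrite leNgt; apply/negP => PFn.
  by apply: nex; exists n; exact: ltW.
by move/cvg_lim : PF_cvg => -> //; rewrite lee_fin leNgt eps0.
Qed.

Lemma borel_cantelli (d : measure_display) (T : measurableType d)
    (R : realType) (P : probability T R) (F : (set T)^nat) (C : R) :
  (forall n, measurable (F n)) -> (forall n, P (F n) <= (C / 2 ^+ n)%:E)%E ->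
  {ae P, forall w, exists n0, forall n, (n0 <= n)%N -> ~ F n w}.
Proof.
move=> mF PF; exists (lim_sup_set F); split.
- by apply: bigcap_measurable => // n _; apply: bigcup_measurable.
- apply: lim_sup_set_cvg0 => //.
  have C0 : 0 <= C.
    by have := PF 0%N; rewrite expr0 divr1 -lee_fin; apply: le_trans.
  apply: (@le_lt_trans _ _ (C * (1 - 2^-1)^-1)%:E); last exact: ltry.
  apply: lime_le; first by apply: is_cvg_nneseries => n _ _; exact: measure_ge0.
  apply: nearW => n.
  apply: (@le_trans _ _ (series (geometric C 2^-1) n)%:E).
    rewrite /series /= -sumEFin; apply: lee_sum => i _.
    by rewrite exprVn; exact: PF.
  rewrite lee_fin geometric_le_lim // ger0_norm //; lra.
- move=> w /= noex n _; apply: contrapT => nF; apply: noex; exists n => m nm Fm.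
  by apply: nF; exists m.
Qed.

Lemma union_bound (d : measure_display) (T : measurableType d) (R : realType)
    (P : probability T R) (I : finType) (E : I -> set T) (c : R) :
  (forall i, measurable (E i)) -> (forall i, P (E i) <= c%:E)%E ->
  measurable (\bigcup_i E i) /\ (P (\bigcup_i E i) <= (#|I|%:R * c)%:E)%E.
Proof.
move=> mE PE.
have -> : \bigcup_i E i = \big[setU/set0]_(i <- enum I) E i.
  rewrite -bigcup_seq; apply: eq_bigcupl; split=> // i _ /=.
  by rewrite mem_enum.
rewrite cardE; elim: (enum I) => [|i s [ms Ps]].
  by rewrite big_nil measure0 mul0r; split.
rewrite big_cons; split; first exact: measurableU.
apply: (le_trans (measureU2 _ _ _)) => //.
by rewrite /= -natr1 mulrDl mul1r addrC EFinD leeD.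
Qed.

(** * Exponential bounds for one family of independent entries *)

Lemma indic_lt (R S : realType) (x y : R) :
  \1_(`]-oo, y[%classic : set R) x = (x < y)%R%:R :> S.
Proof.
rewrite indicE; congr ((nat_of_bool _)%:R); apply/idP/idP => [/set_mem|xy].
  by rewrite /= in_itv.
by apply/mem_set; rewrite /= in_itv.
Qed.

Lemma indic_gt (R S : realType) (x y : R) :
  \1_(`]y, +oo[%classic : set R) x = (y < x)%R%:R :> S.
Proof.
rewrite indicE; congr ((nat_of_bool _)%:R); apply/idP/idP => [/set_mem|xy].
  by rewrite /= in_itv andbT.
by apply/mem_set; rewrite /= in_itv /= andbT.
Qed.

(* Chernoff's bound: the expectation of the product over D of
   1 + (8^r - 1) 1_{X_p < delta} is at most 2^n. *)
Lemma few_small_entries (d : measure_display) (T : measurableType d)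
    (R : realType) (P : probability T R) (I : finType) (D : {set I})
    (X : I -> {RV P >-> R}) (delta : R) (r n : nat) :
  mutually_independent D X -> (#|D| <= n)%N ->
  (forall p, (8 ^+ r - 1) * fine (P (X p @^-1` `]-oo, delta[)) <= 1) ->
  exists E : set T, [/\ measurable E, (P E <= (4^-1 ^+ n)%:E)%E &
    forall w, ~ E w -> (r * #|[set p in D | (X p w < delta)%R]%SET| < n)%N].
Proof.
move=> indepX cD small.
have r81 : 1 <= 8 ^+ r :> R by rewrite exprn_ege1 // ler1n.
(* A factor is 8^r at a small entry and 1 elsewhere, so the product reaches 8^n exactly when r times
   the number of small entries reaches n. Each factor has mean at most 2, and Markov gives 2^n / 8^n
   = 4^-n. *)
pose a b : R := if b then 8 ^+ r - 1 else 1.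
pose V b : set R := if b then `]-oo, delta[%classic else setT.
have [] := @prod_simple_markov _ _ _ P _ _ X _ true a V (8 ^+ n) 2 indepX.
- by case=> /=; rewrite ?subr_ge0.
- by case=> /=; [exact: measurable_itv|exact: measurableT].
- by rewrite exprn_gt0.
- move=> p _; rewrite big_bool /= preimage_setT probability_setT mulr1.
  by have := small p; lra.
move=> mE PE; eexists; split; first exact: mE.
  apply: le_trans PE _; rewrite lee_fin.
  apply: (@le_trans _ _ (2 ^+ n / 8 ^+ n)).
    by rewrite ler_pM2r ?invr_gt0 ?exprn_gt0 // ler_weXn2l // ler1n.
  by rewrite -expr_div_n (_ : 2 / 8 = 4^-1) //; lra.
move=> w /= /negP; rewrite -ltNge.
have -> : \prod_(p in D) \sum_b a b * \1_(V b) (X p w)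
    = 8 ^+ (r * #|[set p in D | (X p w < delta)%R]%SET|) :> R.
  rewrite exprM -prodr_const.
  rewrite [RHS](eq_bigl (fun p => (p \in D) && (X p w < delta))) /=; last first.
    by move=> p; rewrite inE.
  rewrite big_mkcondr /=; apply: eq_bigr => p _.
  rewrite big_bool /= indicT mulr1 indic_lt.
  by case: ifP => _; rewrite ?mulr1 ?mulr0 ?add0r // subrK.
by rewrite ltr_eXn2l // ltr1n.
Qed.

(** The sum is the ceiling of x. The induction on L goes through for the truncation min(x, L). *)
Lemma indic_sum_ge (R : realType) (x : R) (L : nat) :
  0 <= x -> x <= L%:R -> x <= \sum_(l < L) (l%:R < x)%R%:R.
Proof.
move=> x0 xL; suff : Num.min x L%:R <= \sum_(l < L) (l%:R < x)%R%:R.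
  by rewrite (min_idPl _).
elim: L {xL} => [|L IHL]; first by rewrite big_ord0 ge_min lexx orbT.
rewrite big_ord_recr /=; have [Lx|xL] := ltP L%:R x.
  move: IHL; rewrite (min_idPr (ltW Lx)) => IHL.
  by rewrite ge_min -natr1 lerD2r IHL orbT.
rewrite addr0 (le_trans _ IHL) //.
by rewrite le_min !ge_min lexx /= xL.
Qed.

(** The induction carries the bound by L as well: if L < x, the first L terms sum to at most L <=
    |x|, and the new term adds 1. *)
Lemma indic_sum_le (R : realType) (x : R) (L : nat) :
  \sum_(l < L) (l%:R < x)%R%:R <= 1 + `|x|.
Proof.
suff [] : \sum_(l < L) (l%:R < x)%R%:R <= L%:R :> R /\
  \sum_(l < L) (l%:R < x)%R%:R <= 1 + `|x| by [].
elim: L => [|L [IH1 IH2]]; first by rewrite !big_ord0; split=> //; rewrite addr_ge0.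
rewrite !big_ord_recr /= -natr1; have [Lx|xL] := ltP L%:R x.
  split; first by rewrite lerD2r.
  by rewrite addrC lerD2l (le_trans IH1) // (le_trans (ltW Lx)) ?ler_norm.
by rewrite addr0; split=> //; rewrite (le_trans IH1) // lerDl.
Qed.

(* The entries are replaced by the sum over l < L of 1_{X_p > l}, which is at
   least X_p when X_p <= L and has a mean bounded uniformly in L; the
   probability that some X_p exceeds L is made negligible by the choice of L. *)
Lemma prod_entries_tail (d : measure_display) (T : measurableType d)
    (R : realType) (P : probability T R) (I : finType) (D : {set I})
    (X : I -> {RV P >-> R}) (n : nat) (mu : R) :
  mutually_independent D X -> (0 < n)%N -> (#|I| <= n ^ 2)%N -> 0 < mu ->
  (forall p L, \sum_(l < L) fine (P (X p @^-1` `]l%:R, +oo[)) <= mu) ->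
  (exists L : nat, forall p, P (X p @^-1` `]L%:R, +oo[) <= (8^-1 ^+ n)%:E)%E ->
  exists E : set T, [/\ measurable E, (P E <= (2 / 2 ^+ n)%:E)%E &
    forall w, ~ E w -> (forall p, 0 <= X p w) ->
    \prod_(p in D) (1 + (n%:R * mu)^-1 * X p w) <= expR (2 * n%:R)].
Proof.
move=> indepX n0 cI mu0 meanX [L tailX].
pose c := (n%:R * mu)^-1.
have nR0 : 0 < n%:R :> R by rewrite ltr0n.
have c0 : 0 < c by rewrite invr_gt0 mulr_gt0.
(* Index 0 carries the constant 1 of a factor, and index l + 1 the term c 1_{X_p > l}. *)
pose a (k : nat) : R := if k is _.+1 then c else 1.
pose V (k : nat) : set R := if k is l.+1 then `]l%:R, +oo[%classic else setT.
have [] := @prod_simple_markov _ _ _ P _ _ X 'I_L.+1 ord0 (fun k => a k) (fun k => V k)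
  (expR (2 * n%:R)) (expR n%:R^-1) indepX.
- by case=> [[|l] ?] //=; rewrite ltW.
- by case=> [[|l] ?] /=; [exact: measurableT|exact: measurable_itv].
- exact: expR_gt0.
(* A factor has mean at most 1 + c mu = 1 + 1/n <= e^(1/n). The at most n^2 factors give e^n against
   the threshold e^(2n), hence a probability at most e^-n <= 2^-n. *)
- move=> p _; rewrite big_ord_recl /= preimage_setT probability_setT mulr1.
  apply: le_trans (expR_ge1Dx _); rewrite lerD2l -mulr_sumr.
  rewrite -ler_pdivlMl // /c invrK -mulrA mulrCA mulfV ?gt_eqF // mulr1.
  exact: meanX.
have [mF PF] := @union_bound _ _ _ P I (fun p => X p @^-1` `]L%:R, +oo[) _
  (fun p => measurable_RV_preimage (X p) (measurable_itv _)) tailX.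
move=> mE PE; eexists; split; first exact: (measurableU _ _ mE mF).
  apply: (le_trans (measureU2 _ _ _)) => //.
  have two_e : 2 <= expR 1 :> R by apply: le_trans (expR_ge1Dx 1).
  rewrite (_ : 2 / _ = 1 / 2 ^+ n + 1 / 2 ^+ n); last by rewrite -mulrDl.
  rewrite EFinD leeD //.
    apply: (le_trans PE); rewrite lee_fin.
    rewrite div1r ler_pdivrMr ?expR_gt0 //.
    apply: (@le_trans _ _ (expR n%:R)).
      apply: (@le_trans _ _ (expR n%:R^-1 ^+ (n ^ 2))).
        apply: ler_weXn2l; last exact: leq_trans (max_card _) cI.
        by apply: le_trans (expR_ge1Dx _); rewrite lerDl invr_ge0 ltW.
      by rewrite -expRM_natr natrX expr2 mulrA mulVf ?mul1r // gt_eqF.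
    rewrite mulrDl mul1r expRD mulrA ler_peMl ?expR_ge0 //.
    rewrite ler_pdivlMl ?exprn_gt0 // mulr1 -[n%:R]mul1r expRM_natr.
    by rewrite lerXn2r ?nnegrE ?expR_ge0.
  apply: (le_trans PF); rewrite lee_fin div1r.
  (* The union bound over at most n^2 <= 4^n entries turns 8^-n into 2^-n. *)
  apply: (@le_trans _ _ (4 ^+ n * 8^-1 ^+ n)).
    rewrite ler_pM2r ?exprn_gt0 ?invr_gt0 //.
    have -> : 4 ^+ n = ((2 ^ n) ^ 2)%:R :> R by rewrite -!natrX -expnM mulnC expnM.
    rewrite ler_nat; apply: (leq_trans cI).
    by rewrite leq_exp2r // ltnW // ltn_expl.
  by rewrite -exprMn -exprVn (_ : 4 * 8^-1 = 2^-1) //; lra.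
move=> w /= /not_orP[/negP + noF] X0; rewrite -ltNge => /ltW; apply: le_trans.
apply: ler_prod => p pD; rewrite addr_ge0 ?mulr_ge0 //=; last exact: ltW.
rewrite big_ord_recl /= indicT mulr1 lerD2l -mulr_sumr ler_pM2l //.
under eq_bigr do rewrite indic_gt.
apply: indic_sum_ge => //; rewrite leNgt; apply/negP => Lx; apply: noF.
by exists p => //=; rewrite in_itv /= andbT.
Qed.

(** * The two triangles of the random matrix *)

Definition upper_triangle (n : nat) : {set 'I_n * 'I_n} :=
  [set p : 'I_n * 'I_n | (p.1 <= p.2)%N]%SET.

(* Z true is the triangle on and above the diagonal of A, and Z false the
   transpose of the triangle on and below it. *)
Lemma independent_triangles (R : realType) (d : measure_display)
    (T : measurableType d) (P : probability T R)
    (A : forall n : nat, 'I_n -> 'I_n -> {RV P >-> R}) :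
  (forall n : nat, independent_entries (A n)) \/
  (forall n : nat, symmetric_independent_entries (A n)) ->
  exists Z : bool -> forall n, 'I_n * 'I_n -> {RV P >-> R},
    [/\ forall b n, mutually_independent (upper_triangle n) (Z b n),
        forall b n p, exists i j, Z b n p = A n i j
      & {ae P, forall w, forall n (i j : 'I_n), A n i j w =
          if (i <= j)%N then Z true n (i, j) w else Z false n (j, i) w}].
Proof.
case=> indepA.
  exists (fun b n p => if b then A n p.1 p.2 else A n p.2 p.1); split.
  - case=> n J U JD mU; first by apply: indepA => //; exact: finset.subsetT.
    pose sw (p : 'I_n * 'I_n) := (p.2, p.1).
    have swK : involutive sw by case.
    have := indepA n (sw @: J)%SET (U \o sw) (finset.subsetT _) (fun p => mU (sw p)).
    rewrite big_imset /=; last by move=> ? ? _ _; exact: (inv_inj swK).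
    under [in RHS]eq_bigr do rewrite swK.
    move=> <-; congr (P _); apply/seteqP; split=> w /= capw p /= pJ.
      by have /imsetP[q qJ ->] := pJ; have := capw q qJ; rewrite /= swK.
    have := capw (sw p) (imset_f _ pJ); by rewrite /= swK.
  - by move=> [] n p; eexists; eexists.
  - by apply: aeW => w n i j; case: ifP.
(* In case II both triangles are the upper one; almost sure symmetry recovers the entries below the
   diagonal. *)
exists (fun b n p => A n p.1 p.2); split.
- by move=> b n; have [] := indepA n.
- by move=> b n p; eexists; eexists.
have : {ae P, forall w n, (random_matrix (A n) w)^T = random_matrix (A n) w}.
  by apply: ae_foralln => n; have [] := indepA n.
apply: filterS => w symA n i j; case: ifP => // _.
by have /matrixP/(_ i j) := symA n; rewrite !mxE.
Qed.

(** A line is coded by a triangle, a side (row or column) and an index. It has at most n entries,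
    all independent, so [few_small_entries] applies; over the 4n lines the failure probabilities add
    up to 4n 4^-n <= 4 / 2^n, which is summable. *)
Lemma few_small_in_lines (R : realType) (d : measure_display)
    (T : measurableType d) (P : probability T R)
    (Z : bool -> forall n, 'I_n * 'I_n -> {RV P >-> R}) (delta : R) (r : nat) :
  (forall b n, mutually_independent (upper_triangle n) (Z b n)) ->
  (forall b n p,
    (8 ^+ r - 1) * fine (P (Z b n p @^-1` `]-oo, delta[)) <= 1) ->
  {ae P, forall w, exists n0, forall n, (n0 <= n)%N ->
    forall (b : bool) (i : 'I_n),
    (r * #|[set j : 'I_n | (i <= j)%N && (Z b n (i, j) w < delta)%R]%SET| < n)%N /\
    (r * #|[set j : 'I_n | (j <= i)%N && (Z b n (j, i) w < delta)%R]%SET| < n)%N}.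
Proof.
move=> indepZ small.
pose line n (l : bool * bool * 'I_n) : {set 'I_n * 'I_n} :=
  [set p in upper_triangle n | (if l.1.2 then p.1 else p.2) == l.2]%SET.
have card_line n l : (#|line n l| <= n)%N.
  rewrite -[X in (_ <= X)%N]card_ord.
  pose h (p : 'I_n * 'I_n) := if l.1.2 then p.2 else p.1.
  rewrite -(@card_in_imset _ _ h); first exact: max_card.
  move=> [i j] [i' j']; rewrite !inE /h /=.
  by case: l.1.2 => /andP[_ /eqP ->] /andP[_ /eqP ->] ->.
have lineE n l : exists E : set T, [/\ measurable E, (P E <= (4^-1 ^+ n)%:E)%E &
    forall w, ~ E w ->
      (r * #|[set p in line n l | (Z l.1.1 n p w < delta)%R]%SET| < n)%N].
  apply: few_small_entries => [J U JD|//|p]; last exact: small.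
  apply: indepZ; apply: fintype.subset_trans JD _.
  by apply/fintype.subsetP => p; rewrite inE => /andP[].
have bad n : exists F : set T, [/\ measurable F, (P F <= (4 / 2 ^+ n)%:E)%E &
    forall w, ~ F w -> forall l,
      (r * #|[set p in line n l | (Z l.1.1 n p w < delta)%R]%SET| < n)%N].
  have [E EP] := choice (lineE n).
  have [mF PF] := @union_bound _ _ _ P _ E (4^-1 ^+ n)
     (fun l => let: And3 mE _ _ := EP l in mE) (fun l => let: And3 _ PE _ := EP l in PE).
  exists (\bigcup_l E l); split=> //.
    apply: (le_trans PF); rewrite lee_fin !card_prod card_bool card_ord natrM.
    rewrite (_ : (2 * 2)%:R = 4) // -mulrA ler_pM2l // -!exprVn.
    apply: (@le_trans _ _ (2 ^+ n * 4^-1 ^+ n)).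
      rewrite ler_pM2r ?exprn_gt0 ?invr_gt0 // -natrX ler_nat.
      by rewrite ltnW // ltn_expl.
    by rewrite -exprMn (_ : 2 * 4^-1 = 2^-1) //; lra.
  by move=> w nF l; have [_ _] := EP l; apply => El; apply: nF; exists l.
have [F FP] := choice bad.
have : {ae P, forall w, exists n0, forall n, (n0 <= n)%N -> ~ F n w}.
  by apply: (@borel_cantelli _ _ _ _ _ 4) => n; have [] := FP n.
apply: filterS => w [n0 nF]; exists n0 => n n0n b i.
have [_ _ /(_ w (nF n n0n)) lineP] := FP n; split.
  have := lineP (b, true, i); apply: leq_ltn_trans; rewrite leq_mul2l.
  apply/orP; right; rewrite -(@card_imset _ _ (fun j => (i, j))); last by move=> ? ? [].
  apply/subset_leq_card/fintype.subsetP => _ /imsetP[j + ->].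
  by rewrite !inE /= eqxx andbT.
have := lineP (b, false, i); apply: leq_ltn_trans; rewrite leq_mul2l.
apply/orP; right; rewrite -(@card_imset _ _ (fun j => (j, i))); last by move=> ? ? [].
apply/subset_leq_card/fintype.subsetP => _ /imsetP[j + ->].
by rewrite !inE /= eqxx andbT.
Qed.

(** * Passage to the limits, and comparison of the ratios *)

(** The tolerances 1/(m+1) are countably many, so almost sure bounds for each of them hold
    simultaneously. *)
Lemma limn_einf_ge (R : realType) (u : (\bar R)^nat) (l : R) :
  (forall m, exists n0, forall n, (n0 <= n)%N -> ((l - m.+1%:R^-1)%:E <= u n)%E) ->
  (l%:E <= limn_einf u)%E.
Proof.
move=> ul; rewrite limn_einf_lim; apply/lee_subgt0Pr => e e0.
have [m _ me] := near_infty_natSinv_lt (PosNum e0).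
have [n0 n0P] := ul m; apply: (@le_trans _ _ (l - m.+1%:R^-1)%:E).
  by rewrite -EFinB lee_fin lerD2l lerN2 ltW // me /=.
apply: lime_ge; first exact: is_cvg_einfs.
exists n0 => // n /= n0n; apply: le_ereal_inf_tmp => _ [k /= nk <-].
by apply: n0P; apply: leq_trans nk.
Qed.

Lemma limn_esup_le (R : realType) (u : (\bar R)^nat) (l : R) :
  (forall m, exists n0, forall n, (n0 <= n)%N -> (u n <= (l + m.+1%:R^-1)%:E)%E) ->
  (limn_esup u <= l%:E)%E.
Proof.
move=> ul; rewrite limn_esup_lim; apply/lee_addgt0Pr => e e0.
have [m _ me] := near_infty_natSinv_lt (PosNum e0).
have [n0 n0P] := ul m; apply: (@le_trans _ _ (l + m.+1%:R^-1)%:E); last first.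
  by rewrite -EFinD lee_fin lerD2l ltW // me /=.
apply: lime_le; first exact: is_cvg_esups.
exists n0 => // n /= n0n; apply: ge_ereal_sup => _ [k /= nk <-].
by apply: n0P; apply: leq_trans nk.
Qed.

(** A itself is an admissible submatrix when alpha <= 1. This lets the lower bound of (i) give the
    inequality limsup >= 1 of (ii). *)
Lemma min_ratio_le_max_ratio (R : realType) (alpha : R) (n : nat) (A : 'M[R]_n) :
  alpha <= 1 -> (min_ratio alpha A <= max_ratio alpha A)%E.
Proof.
move=> a1; pose B : 'M[R]_#|[set: 'I_n]%SET| :=
  \matrix_(i, j) A (enum_val i) (enum_val j).
have ratioB : log_permanent_ratios alpha A
    (ln (permanent B) / (#|[set: 'I_n]%SET|%:R * ln #|[set: 'I_n]%SET|%:R))%:E.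
  exists #|[set: 'I_n]%SET|, B; split=> //.
  - by rewrite cardsT card_ord ler_piMl.
  - by rewrite cardsT card_ord.
  - exists [set: 'I_n]%SET, [set: 'I_n]%SET, erefl, erefl.
    by apply/matrixP => i j; rewrite castmxE !mxE !cast_ord_id.
exact: le_trans (ereal_inf_lbound ratioB) (ereal_sup_ubound ratioB).
Qed.

(** The pointwise bound [indic_sum_le] is integrated; the result does not depend on L. *)
Lemma tail_sum_le (d : measure_display) (T : measurableType d) (R : realType)
    (P : probability T R) (X : {RV P >-> R}) (L : nat) :
  (\int[P]_w `|X w|%:E < +oo)%E ->
  \sum_(l < L) fine (P (X @^-1` `]l%:R, +oo[))
    <= 1 + fine (\int[P]_w `|X w|%:E)%E.
Proof.
move=> finX.
have mtail l : measurable (X @^-1` `]l%:R, +oo[).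
  by apply: measurable_RV_preimage; exact: measurable_itv.
have mabs : measurable_fun [set: T] (fun w => `|X w|%:E).
  by apply/measurable_EFinP; apply: measurableT_comp => //; exact: measurable_funPT.
have abs_ge0 : (0 <= \int[P]_w `|X w|%:E)%E.
  by apply: integral_ge0 => w _; rewrite lee_fin.
rewrite -lee_fin EFinD fineK ?ge0_fin_numE // -sumEFin.
have -> : (1%:E + \int[P]_w `|X w|%:E = \int[P]_w (1%:E + `|X w|%:E))%E.
  have int1 : (\int[P]_w (cst 1%:E w) = 1%:E)%E.
    by rewrite integral_cst // mul1e; exact: probability_setT.
  rewrite -[X in (X + _)%E]int1 -ge0_integralD //.
rewrite (eq_bigr (fun l : 'I_L => \int[P]_w (\1_(X @^-1` `]l%:R, +oo[) w)%:E)%E).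
  rewrite -ge0_integral_sum //=; last first.
    by move=> l; apply/measurable_EFinP.
  apply: ge0_le_integral => //=.
  - by move=> w _; apply: sume_ge0 => l _; rewrite lee_fin.
  - by apply: emeasurable_sum => l; apply/measurable_EFinP.
  - by apply: emeasurable_funD.
  - move=> w _; rewrite sumEFin -EFinD lee_fin.
    apply: le_trans (indic_sum_le (X w) L).
    by apply: ler_sum => l _; rewrite -(@indic_gt R R).
by move=> l _; rewrite integral_indic // setIT fineK // fin_num_measure.
Qed.

(** The right-hand side counts the diagonal twice; the extra factors h (i, i) are at least 1. *)
Lemma prod_triangles (R : realType) (n : nat) (g h : 'I_n * 'I_n -> R)
    (B : 'M[R]_n) :
  (forall i j, B i j = if (i <= j)%N then g (i, j) else h (j, i)) ->
  (forall p, 1 <= g p) -> (forall p, 1 <= h p) ->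
  \prod_i \prod_j B i j
    <= (\prod_(p in upper_triangle n) g p) * \prod_(p in upper_triangle n) h p.
Proof.
move=> BE g1 h1; pose sw (p : 'I_n * 'I_n) := (p.2, p.1).
have sw_inj : injective sw by apply: inv_inj; case.
have prod_ge0 Q (k : 'I_n * 'I_n -> R) : (forall p, 1 <= k p) -> 0 <= \prod_(p | Q p) k p.
  by move=> k1; apply: prodr_ge0 => p _; apply: le_trans (k1 p).
rewrite pair_big /= (bigID (mem (upper_triangle n))) /=.
have -> : \prod_(p in upper_triangle n) B p.1 p.2 = \prod_(p in upper_triangle n) g p.
  by apply: eq_bigr => -[i j]; rewrite inE BE /= => ->.
rewrite ler_wpM2l ?prod_ge0 // (reindex_inj sw_inj) /=.
rewrite [leRHS](bigID (fun p => sw p \notin upper_triangle n)) /=.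
have -> : \prod_(p | sw p \notin upper_triangle n) B p.2 p.1
    = \prod_(p in upper_triangle n | sw p \notin upper_triangle n) h p.
  apply: eq_big => [[i j]|[i j]]; rewrite !inE /=.
    by rewrite -ltnNge andb_idl // => /ltnW.
  by rewrite BE => /negPf ->.
rewrite ler_peMr ?prod_ge0 //; elim/big_rec: _ => // p x _ x1.
exact: mulr_ege1.
Qed.

(** * Almost sure bounds on the ratios *)

Lemma ae_entries_gt0 (R : realType) (d : measure_display) (T : measurableType d)
    (P : probability T R) (A : forall n : nat, 'I_n -> 'I_n -> {RV P >-> R}) :
  (forall (n : nat) (i j : 'I_n), {ae P, forall w, 0 < A n i j w}) ->
  {ae P, forall w n i j, 0 < A n i j w}.
Proof.
move=> A_gt0.
apply: ae_foralln => n; apply: filter_forall => i; apply: filter_forall => j.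
exact: A_gt0.
Qed.

Lemma law_nonpos_eq0 (R : realType) (d : measure_display) (T : measurableType d)
    (P : probability T R) (A : forall n : nat, 'I_n -> 'I_n -> {RV P >-> R})
    (d' : measure_display) (T' : measurableType d') (Q : probability T' R)
    (xi : {RV Q >-> R}) :
  (forall (n : nat) (i j : 'I_n), {ae P, forall w, 0 < A n i j w}) ->
  (forall (n : nat) (i j : 'I_n), same_distribution (A n i j) xi) ->
  Q (xi @^-1` `]-oo, 0]) = 0%E.
Proof.
move=> A_gt0 A_distr.
have <- : P (A 1%N ord0 ord0 @^-1` `]-oo, 0]) = Q (xi @^-1` `]-oo, 0]).
  by apply: A_distr; exact: measurable_itv.
apply: measure_negligible.
  by apply: measurable_RV_preimage; exact: measurable_itv.
apply: negligibleS (A_gt0 1%N ord0 ord0) => w /=.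
by rewrite in_itv /= => A0; apply/negP; rewrite -leNgt.
Qed.

Lemma ae_min_ratio_ge (R : realType) (d : measure_display) (T : measurableType d)
    (P : probability T R) (A : forall n : nat, 'I_n -> 'I_n -> {RV P >-> R})
    (d' : measure_display) (T' : measurableType d') (Q : probability T' R)
    (xi : {RV Q >-> R}) (alpha : R) :
  (forall (n : nat) (i j : 'I_n), {ae P, forall w, 0 < A n i j w}) ->
  (forall (n : nat) (i j : 'I_n), same_distribution (A n i j) xi) ->
  (forall n : nat, independent_entries (A n)) \/
    (forall n : nat, symmetric_independent_entries (A n)) ->
  0 < alpha ->
  {ae P, forall w m, exists n0, forall n, (n0 <= n)%N ->
  ((1 - m.+1%:R^-1)%:E <= min_ratio alpha (random_matrix (A n) w))%E}.
Proof.
move=> A_gt0 A_distr A_indep alpha_gt0.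
have A_law n i j := A_distr n i j :
  forall U, measurable U -> P (A n i j @^-1` U) = Q (xi @^-1` U).
have xi_gt0 := law_nonpos_eq0 A_gt0 A_distr.
have ae_A_gt0 := ae_entries_gt0 A_gt0.
have [Z [indepZ ZA aeZ]] := independent_triangles A_indep.
apply: ae_foralln => m.
have [||r [r0 rP]] := @min_ratio_ge R alpha m.+1%:R^-1 alpha_gt0.
- by rewrite invr_gt0.
- by rewrite invf_le1 // ler1n.
have r8 : 0 < 8 ^+ r :> R by rewrite exprn_gt0.
(* The events xi < 1/(k+1) decrease to the null event xi <= 0, so some delta = 1/(k+1) has Q(xi <
   delta) <= 8^-r. *)
have [||||k small] := @nonincreasing_measure_small _ _ _ Q
    (fun k => xi @^-1` `]-oo, k.+1%:R^-1[) (8 ^+ r)^-1.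
- by move=> k; apply: measurable_RV_preimage; exact: measurable_itv.
- move=> k l kl; apply/subsetPset => w /=; rewrite !in_itv /= => /lt_le_trans; apply.
  by rewrite lef_pV2 ?posrE // ler_nat.
- rewrite -[RHS]xi_gt0; congr (Q _); apply/seteqP; split=> w /=.
    move=> xik; rewrite in_itv /= leNgt; apply/negP => xi0.
    have [k _ kP] := near_infty_natSinv_lt (PosNum xi0).
    have := xik k I; rewrite /= in_itv /= => /(lt_trans (kP k (leqnn k))).
    by rewrite /= ltxx.
  by rewrite in_itv /= => xi0 k _; rewrite /= in_itv /= (le_lt_trans xi0) // invr_gt0.
- by rewrite invr_gt0.
set delta := k.+1%:R^-1 in small.
have delta0 : 0 < delta by rewrite invr_gt0.
have [n0 n0P] := rP delta delta0.
have := @few_small_in_lines _ _ _ P Z delta r indepZ.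
have small' b n p : (8 ^+ r - 1) * fine (P (Z b n p @^-1` `]-oo, delta[)) <= 1.
  have [i [j ->]] := ZA b n p; rewrite A_law; last exact: measurable_itv.
  have q1 : fine (Q (xi @^-1` `]-oo, delta[)) <= (8 ^+ r)^-1.
    rewrite -lee_fin fineK // fin_num_measure //.
    by apply: measurable_RV_preimage; exact: measurable_itv.
  have q0 : 0 <= fine (Q (xi @^-1` `]-oo, delta[)) by rewrite fine_ge0.
  move: q1; rewrite -[(8 ^+ r)^-1]mul1r ler_pdivlMr // mulrC => q1.
  by rewrite mulrBl mul1r lerBlDr (le_trans q1) // lerDl.
move=> /(_ small'); move: aeZ ae_A_gt0; apply: filterS3 => w ZE A0 [n1 n1P].
exists (maxn n0 n1) => n; rewrite geq_max => /andP[n0n n1n].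
apply: n0P => // [i j|i|j]; first by rewrite mxE.
(* Row i of A_n is covered by row i of [Z true] and column i of [Z false], each with fewer than n/r
   small entries; hence the bound 2n. *)
- have [lt1 _] := n1P n n1n true i; have [_ lt2] := n1P n n1n false i.
  rewrite -addnn; apply: leq_trans (leq_add (ltnW lt1) (ltnW lt2)).
  rewrite -mulnDr leq_mul2l; apply/orP; right.
  apply: leq_trans (leq_card_setU _ _); apply/subset_leq_card/fintype.subsetP => j.
  rewrite !inE mxE ZE; have [_|ji] := leqP i j => [-> //|].
  by rewrite /= (ltnW ji).
- have [_ lt1] := n1P n n1n true j; have [lt2 _] := n1P n n1n false j.
  rewrite -addnn; apply: leq_trans (leq_add (ltnW lt1) (ltnW lt2)).
  rewrite -mulnDr leq_mul2l; apply/orP; right.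
  apply: leq_trans (leq_card_setU _ _); apply/subset_leq_card/fintype.subsetP => i.
  rewrite !inE mxE ZE; have [_|ji] := leqP i j => [-> //|].
  by rewrite /= (ltnW ji).
Qed.

Lemma ae_max_ratio_le (R : realType) (d : measure_display) (T : measurableType d)
    (P : probability T R) (A : forall n : nat, 'I_n -> 'I_n -> {RV P >-> R})
    (d' : measure_display) (T' : measurableType d') (Q : probability T' R)
    (xi : {RV Q >-> R}) (alpha : R) :
  (forall (n : nat) (i j : 'I_n), {ae P, forall w, 0 < A n i j w}) ->
  (forall (n : nat) (i j : 'I_n), same_distribution (A n i j) xi) ->
  (forall n : nat, independent_entries (A n)) \/
    (forall n : nat, symmetric_independent_entries (A n)) ->
  0 < alpha -> ('E_Q[xi] \is a fin_num)%E ->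
  {ae P, forall w m, exists n0, forall n, (n0 <= n)%N ->
  (max_ratio alpha (random_matrix (A n) w) <= (1 + m.+1%:R^-1)%:E)%E}.
Proof.
move=> A_gt0 A_distr A_indep alpha_gt0 mean_fin.
have A_law n i j := A_distr n i j :
  forall U, measurable U -> P (A n i j @^-1` U) = Q (xi @^-1` U).
have xi_gt0 := law_nonpos_eq0 A_gt0 A_distr.
have ae_A_gt0 := ae_entries_gt0 A_gt0.
have [Z [indepZ ZA aeZ]] := independent_triangles A_indep.
have int_abs : (\int[Q]_w `|xi w|%:E < +oo)%E.
  (* The mean equals the absolute mean because xi is almost surely positive. *)
  have -> : (\int[Q]_w `|xi w|%:E = 'E_Q[xi])%E.
    rewrite expectation.unlock; apply: ae_eq_integral => //.
    - by apply/measurable_EFinP; apply: measurableT_comp => //; exact: measurable_funPT.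
    - by apply/measurable_EFinP; exact: measurable_funPT.
    exists (xi @^-1` `]-oo, 0]); split=> //.
      by apply: measurable_RV_preimage; exact: measurable_itv.
    move=> w /= nabs; rewrite in_itv /= leNgt; apply/negP => xi0; apply: nabs => _.
    by rewrite gtr0_norm.
  by rewrite ltey_eq mean_fin.
set mu := 1 + fine (\int[Q]_w `|xi w|%:E)%E.
have mu0 : 0 < mu.
  by rewrite ltr_wpDr // fine_ge0 // integral_ge0 // => w _; rewrite lee_fin.
have mean b n p L : \sum_(l < L) fine (P (Z b n p @^-1` `]l%:R, +oo[)) <= mu.
  have [i [j ->]] := ZA b n p.
  under eq_bigr do rewrite A_law //.
  exact: tail_sum_le.
(* The truncation level may depend on n, since only a tail bound 8^-n is asked of it. *)
have tail n : exists L : nat, forall b p,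
    (P (Z b n p @^-1` `]L%:R, +oo[) <= (8^-1 ^+ n)%:E)%E.
  have [||||L tailL] := @nonincreasing_measure_small _ _ _ Q
    (fun k => xi @^-1` `]k%:R, +oo[) (8^-1 ^+ n).
  - by move=> k; apply: measurable_RV_preimage; exact: measurable_itv.
  - move=> k l kl; apply/subsetPset => w /=; rewrite !in_itv /= !andbT.
    by apply: le_lt_trans; rewrite ler_nat.
  - rewrite -[RHS](measure0 Q); congr (Q _); apply/seteqP; split=> // w /= xik.
    have := xik (Num.bound `|xi w|) I; rewrite /= in_itv /= andbT ltNge => /negP; apply.
    by apply/ltW/(le_lt_trans (ler_norm _))/archi_boundP.
  - by rewrite exprn_gt0.
  by exists L => b p; have [i [j ->]] := ZA b n p; rewrite A_law.
have bad n : exists F : set T, [/\ measurable F, (P F <= (4 / 2 ^+ n)%:E)%E &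
    forall w, ~ F w -> (0 < n)%N -> (forall b p, 0 <= Z b n p w) -> forall b,
    \prod_(p in upper_triangle n) (1 + (n%:R * mu)^-1 * Z b n p w)
      <= expR (2 * n%:R)].
  have [->|n0] := posnP n.
    by exists set0; split=> //; rewrite measure0 lee_fin divr_ge0 ?exprn_ge0.
  have EP b := @prod_entries_tail _ _ _ P _ _ (Z b n) n mu (indepZ b n) n0.
  have cI : (#|{: 'I_n * 'I_n}| <= n ^ 2)%N by rewrite card_prod card_ord.
  have tailb b : exists L : nat, forall p,
      (P (Z b n p @^-1` `]L%:R, +oo[) <= (8^-1 ^+ n)%:E)%E.
    by have [L LP] := tail n; exists L => p.
  have [E {}EP] := choice (fun b => EP b cI mu0 (mean b n) (tailb b)).
  have [mF PF] := @union_bound _ _ _ P _ E (2 / 2 ^+ n)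
     (fun b => let: And3 mE _ _ := EP b in mE) (fun b => let: And3 _ PE _ := EP b in PE).
  exists (\bigcup_b E b); split=> //.
    by apply: le_trans PF _; rewrite card_bool lee_fin mulrA (_ : 2%:R * 2 = 4) //; lra.
  move=> w nF _ Z0 b; have [_ _] := EP b; apply=> // Eb.
  by apply: nF; exists b.
have [F FP] := choice bad.
have aeF : {ae P, forall w, exists n0, forall n, (n0 <= n)%N -> ~ F n w}.
  by apply: (@borel_cantelli _ _ _ _ _ 4) => n; have [] := FP n.
apply: ae_foralln => m.
(* The constant 4 is the sum of the exponents 2n of the two triangles, divided by n. *)
have [|n0 n0P] := @max_ratio_le R alpha m.+1%:R^-1 mu 4 alpha_gt0 _ mu0 (ler0n _ 4).
  by rewrite invr_gt0.
move: aeZ ae_A_gt0 aeF; apply: filterS3 => w ZE A0 [n1 n1P].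
exists (maxn 1 (maxn n0 n1)) => n; rewrite !geq_max => /and3P[n_gt0 n0n n1n].
have Z0 b p : 0 <= Z b n p w by have [i [j ->]] := ZA b n p; exact: ltW.
have [_ _ /(_ w (n1P n n1n) n_gt0 (fun b => Z0 b)) prodZ] := FP n.
apply: n0P => // [i j|]; first by rewrite mxE.
have c0 : 0 <= (n%:R * mu)^-1 by rewrite invr_ge0 mulr_ge0 // ltW.
pose g b p := 1 + (n%:R * mu)^-1 * Z b n p w.
have g1 b p : 1 <= g b p by rewrite lerDl mulr_ge0.
have := @prod_triangles _ _ (g true) (g false)
  (\matrix_(i, j) (1 + (n%:R * mu)^-1 * A n i j w)) _ (g1 true) (g1 false).
under eq_bigr do under eq_bigr do rewrite !mxE.
under [in X in _ -> X]eq_bigr do under eq_bigr do rewrite mxE.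
move=> prodle; apply: le_trans (prodle _) _ => [i j|].
  by rewrite mxE ZE; case: ifP.
rewrite (_ : 4 * n%:R = 2 * n%:R + 2 * n%:R); last by lra.
rewrite expRD ler_pM ?prodZ // prodr_ge0 // => p _.
- exact: le_trans (g1 true p).
- exact: le_trans (g1 false p).
Qed.

Theorem theorem2 (R : realType)
    (d : measure_display) (T : measurableType d) (P : probability T R)
    (A : forall n : nat, 'I_n -> 'I_n -> {RV P >-> R})
    (d' : measure_display) (T' : measurableType d') (Q : probability T' R)
    (xi : {RV Q >-> R}) (alpha : R)
    (A_gt0 : forall (n : nat) (i j : 'I_n), {ae P, forall w, 0 < A n i j w})
    (A_distr : forall (n : nat) (i j : 'I_n), same_distribution (A n i j) xi)
    (A_indep : (forall n : nat, independent_entries (A n)) \/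
               (forall n : nat, symmetric_independent_entries (A n)))
    (alpha_gt0 : 0 < alpha) (alpha_lt1 : alpha < 1) :
  {ae P, forall w,
    (1 <= limn_einf (fun n => min_ratio alpha (random_matrix (A n) w)))%E} /\
  (('E_Q[xi] \is a fin_num)%E ->
   {ae P, forall w,
     limn_esup (fun n => max_ratio alpha (random_matrix (A n) w)) = 1%E}).
Proof.
have aemin := ae_min_ratio_ge A_gt0 A_distr A_indep alpha_gt0.
split; first by apply: filterS aemin => w minP; exact: limn_einf_ge.
move=> /(ae_max_ratio_le A_gt0 A_distr A_indep alpha_gt0).
move: aemin; apply: filterS2 => w minP maxP.
apply/eqP; rewrite eq_le limn_esup_le //=.
(* The limsup of the maxima dominates their liminf, which inherits the lower bound on the minima. *)
apply: le_trans (limn_einf_sup _); apply: limn_einf_ge => m.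
have [n0 n0P] := minP m; exists n0 => n /n0P /le_trans; apply.
exact/min_ratio_le_max_ratio/ltW.
Qed.
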